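(* Let $G$ be a finitely generated group and let $H$ be a finitely generated subgroup of $G$. If $G$ is polynomially full, then $H$ is also polynomially full.
   Context: For a finitely generated group $G$, $G^{fin}$ is the set of finite order elements. Fixing a word length norm $\lVert\cdot\rVert$ from a finite generating set of $G$, for $h\in G$ let $C(h)$ be its conjugacy class in $G$ and $n_{h,l}:=|\{g\in C(h):\lVert g\rVert=l\}|$; $C(h)$ has polynomial growth if there are $c\in\mathbb{R}_{>0}$ and $d\in\mathbb{N}$ with $n_{h,l}\leq c\cdot l^d$ for all $l\in\mathbb{N}=\{1,2,\dots\}$; $G^{pol}:=\{g\in G : C(g)\text{ has polynomial growth}\}$. A finitely generated group $G$ is polynomially full if $G^{fin}\subseteq G^{pol}$. *)

(* Defs.v *)
From HB Require Import structures.
From mathcomp Require Import all_boot all_order all_algebra.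
From mathcomp Require Import finmap.
From mathcomp Require Import boolp classical_sets functions cardinality reals.

Set Implicit Arguments.
Unset Strict Implicit.
Unset Printing Implicit Defensive.

Local Open Scope classical_set_scope.
Local Open Scope group_scope.

Section WordNorm.
Variable G : groupType.
Implicit Types (A : {fset G}) (g h : G) (w : seq G) (l n : nat).

Definition is_word A w : bool := all (fun x => (x \in A) || (x^-1 \in A)) w.

Definition word_value w : G := \prod_(x <- w) x.

Definition is_product_of_length A g n : Prop :=
  exists w, [/\ is_word A w, size w = n & word_value w = g].

Definition generates A : Prop := forall g, exists n, is_product_of_length A g n.

Record fin_gen_set := FinGenSet {
  gens :> {fset G};
  gensP : generates gens
}.

Fact word_norm_subproof (S : fin_gen_set) g :
  exists n, `[< is_product_of_length S g n >].
Proof. by have [n gn] := gensP S g; exists n; apply/asboolP. Qed.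

Definition word_norm (S : fin_gen_set) g : nat :=
  ex_minn (word_norm_subproof S g).

Definition conj_class h : set G := range (fun x : G => h ^ x).

Definition class_sphere (S : fin_gen_set) h l : set G :=
  [set g | conj_class h g /\ word_norm S g = l].

(* [fset_set] is only meaningful on finite sets: see [finite_class_sphere]. *)
Definition class_growth (S : fin_gen_set) h l : nat :=
  #|` fset_set (class_sphere S h l)|%fset.

Definition finite_order_elements : set G :=
  [set g | exists2 n, (0 < n)%N & g ^+ n = 1].

Lemma finite_word_values A n : finite_set [set g | is_product_of_length A g n].
Proof.
elim: n => [|n IHn].
  apply: (@sub_finite_set _ _ [set 1]); last exact: finite_set1.
  by move=> g [w [_ /size0nil -> <-]]; rewrite /word_value big_nil.
have finL : finite_set [set x : G |
    x \in (A : seq G) ++ [seq x^-1 | x <- (A : seq G)]].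
  exact: finite_seq.
apply: sub_finite_set (finite_image2 (fun x y : G => x * y) finL IHn).
move=> g [[|x w] [] //= /andP[xA wA] [sw] <-].
exists x => /=.
  rewrite mem_cat; case/orP: xA => [->//|xA]; apply/orP; right.
  by apply/mapP; exists x^-1 => //; rewrite invgK.
by exists (word_value w); [exists w|rewrite /word_value big_cons].
Qed.

Lemma finite_class_sphere (S : fin_gen_set) h l :
  finite_set (class_sphere S h l).
Proof.
apply: sub_finite_set (finite_word_values S l) => g [_ <-] /=.
by rewrite /word_norm; case: ex_minnP => n /asboolP.
Qed.

End WordNorm.

Section PolynomialFullness.
Variable R : realType.
Local Open Scope ring_scope.

(* Both l and d range over the positive integers. *)
Definition poly_growth_class (G : groupType) (S : fin_gen_set G) (h : G) :=
  exists (c : R) (d : nat), [/\ 0 < c, (0 < d)%N &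
    forall l : nat, (0 < l)%N -> (class_growth S h l)%:R <= c * l%:R ^+ d].

Definition poly_elements (G : groupType) (S : fin_gen_set G) : set G :=
  [set g | poly_growth_class S g].

Definition polynomially_full (G : groupType) (S : fin_gen_set G) : Prop :=
  @finite_order_elements G `<=` poly_elements S.

End PolynomialFullness.

(* Main.v *)
Require Import Defs.
From mathcomp Require Import all_boot all_algebra reals.
From mathcomp Require Import order finmap boolp classical_sets cardinality.

Set Implicit Arguments.
Unset Strict Implicit.
Unset Printing Implicit Defensive.

Import Order.TTheory GRing.Theory Num.Theory.

(** An injective homomorphism [f : H -> G] of finitely generated groups is
    Lipschitz for the word norms: writing an element of [H] as a word in the
    generators of [H], and each letter as a word in the generators of [G],
    multiplies lengths by at most a constant [M]
    ([word_norm_morph_lipschitz]).  Moreover [f] maps the conjugacy class of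
    [h] into the conjugacy class of [f h].  The elements of norm [l > 0] in the
    class of [h] thus embed into the union of the spheres of radius
    [1, ..., M * l] in the class of [f h] ([class_growth_morph]).  If these
    spheres have at most [c * k ^ d] elements, their union has at most
    [M * l * c * (M * l) ^ d = c * M ^ (d + 1) * l ^ (d + 1)], so polynomial
    growth passes from the class of [f h] to that of [h]
    ([poly_growth_class_morph]).  Since [f] preserves elements of finite order,
    applying this to the inclusion of a subgroup gives the theorem. *)

Local Open Scope classical_set_scope.
Local Open Scope group_scope.

Lemma word_normP (G : groupType) (S : fin_gen_set G) g :
  is_product_of_length S g (word_norm S g).
Proof. by rewrite /word_norm; case: ex_minnP => n /asboolP. Qed.

Lemma word_norm_le (G : groupType) (S : fin_gen_set G) g n :
  is_product_of_length S g n -> (word_norm S g <= n)%N.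
Proof.
by move=> gn; rewrite /word_norm; case: ex_minnP => m _; apply; apply/asboolP.
Qed.

Lemma word_norm1 (G : groupType) (S : fin_gen_set G) :
  word_norm S (1 : G) = 0%N.
Proof.
apply/eqP; rewrite -leqn0; apply: word_norm_le.
by exists [::]; split=> //; rewrite /word_value big_nil.
Qed.

Lemma word_norm_eq0 (G : groupType) (S : fin_gen_set G) (g : G) :
  word_norm S g = 0%N -> g = 1.
Proof.
move=> g0; have := word_normP S g; rewrite g0 => -[w [_ /size0nil -> <-]].
by rewrite /word_value big_nil.
Qed.

Lemma word_normM (G : groupType) (S : fin_gen_set G) (x y : G) :
  (word_norm S (x * y)%g <= word_norm S x + word_norm S y)%N.
Proof.
have [u [uS <- xE]] := word_normP S x; have [v [vS <- yE]] := word_normP S y.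
apply: word_norm_le; exists (u ++ v); split; last 2 first.
- by rewrite size_cat.
- by rewrite /word_value big_cat /= -/(word_value u) -/(word_value v) xE yE.
- by rewrite /is_word all_cat; apply/andP.
Qed.

(** By subadditivity, any bound on the images of the generators and of their
    inverses is a Lipschitz constant. *)
Lemma word_norm_morph_lipschitz (G H : groupType)
    (f : UMagmaMorphism.type H G)
    (S : fin_gen_set G) (T : fin_gen_set H) :
  exists M : nat, forall h : H, (word_norm S (f h) <= M * word_norm T h)%N.
Proof.
pose N x := maxn (word_norm S (f x)) (word_norm S (f x^-1)).
exists (\max_(x <- gens T) N x) => h.
have leN x : x \in gens T -> (N x <= \max_(x <- gens T) N x)%N.
  by move=> xT; apply: leq_bigmax_seq.
have [w [wT <- <-]] := word_normP T h.
elim: w wT => [_|x w IHw /= /andP[xT /IHw {}IHw]].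
  by rewrite /word_value big_nil gmulf1 word_norm1.
rewrite /word_value big_cons -/(word_value w) gmulfM mulnS.
apply: leq_trans (word_normM _ _ _) (leq_add _ IHw).
case/orP: xT => /leN; apply: leq_trans; first exact: leq_maxl.
by rewrite /N invgK leq_maxr.
Qed.

Lemma conj_class_morph (G H : groupType)
    (f : UMagmaMorphism.type H G) (h g : H) :
  conj_class h g -> conj_class (f h) (f g).
Proof. by case=> x _ <-; exists (f x); rewrite ?gmulfJ. Qed.

(** The union starts at radius 1 because [f g = 1] only for [g = 1], which has
    norm 0; thus a bound on spheres of positive radius suffices. *)
Lemma class_growth_morph (G H : groupType)
    (f : UMagmaMorphism.type H G)
    (S : fin_gen_set G) (T : fin_gen_set H) (M : nat) (h : H) (l : nat) :
    injective f ->
    (forall g : H, (word_norm S (f g) <= M * word_norm T g)%N) ->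
    (0 < l)%N ->
  (class_growth T h l <= \sum_(1 <= k < (M * l).+1) class_growth S (f h) k)%N.
Proof.
move=> f_inj fM l_gt0.
pose B k : seq G := fset_set (class_sphere S (f h) k).
have -> : (\sum_(1 <= k < (M * l).+1) class_growth S (f h) k)%N =
    size (flatten [seq B k | k <- index_iota 1 (M * l).+1]).
  by rewrite size_flatten /shape sumnE !big_map.
rewrite /class_growth -(size_map f); apply: uniq_leq_size.
  by rewrite map_inj_uniq// fset_uniq.
move=> _ /mapP[g + ->]; rewrite in_fset_set; last exact: finite_class_sphere.
rewrite inE => -[hg gl]; apply/flatten_mapP; exists (word_norm S (f g)).
  rewrite mem_index_iota ltnS -gl fM andbT lt0n; apply/eqP => /word_norm_eq0.
  rewrite -(@gmulf1 _ _ f) => /f_inj g1.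
  by rewrite -gl g1 word_norm1 in l_gt0.
rewrite /B in_fset_set; last exact: finite_class_sphere.
by rewrite inE; split=> //; apply: conj_class_morph.
Qed.

Lemma poly_growth_class_morph (R : realType) (G H : groupType)
    (f : UMagmaMorphism.type H G)
    (S : fin_gen_set G) (T : fin_gen_set H) (h : H) :
  injective f -> poly_growth_class R S (f h) -> poly_growth_class R T h.
Proof.
move=> f_inj [c [d [c_gt0 d_gt0 growth]]].
have [M0 fM0] := word_norm_morph_lipschitz f S T.
(* The constant M0 may vanish (when H is trivial), but c * M ^ (d + 1) has to
   be positive. *)
pose M := M0.+1.
have fM g : (word_norm S (f g) <= M * word_norm T g)%N.
  by apply: leq_trans (fM0 g) _; rewrite leq_mul2r leqnSn orbT.
exists (c * M%:R ^+ d.+1)%R, d.+1; split=> // [|l l_gt0].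
  by rewrite mulr_gt0// exprn_gt0// ltr0n.
apply: (@le_trans _ _ (\sum_(1 <= k < (M * l).+1) c * (M * l)%:R ^+ d)%R).
  apply: (@le_trans _ _
    (\sum_(1 <= k < (M * l).+1) class_growth S (f h) k)%:R%R).
    by rewrite ler_nat; apply: class_growth_morph.
  rewrite natr_sum big_seq [leRHS]big_seq; apply: ler_sum => k.
  rewrite mem_index_iota ltnS => /andP[k_gt0 kM].
  apply: le_trans (growth k k_gt0) _; rewrite ler_pM2l//.
  by rewrite lerXn2r ?nnegrE ?ler0n// ler_nat.
rewrite sumr_const_nat subn1 /= -[leRHS]mulrA -exprMn -natrM.
by rewrite -[leLHS]mulr_natr -mulrA -exprSr.
Qed.

Lemma finite_order_morph (G H : groupType)
    (f : UMagmaMorphism.type H G) (h : H) :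
  @finite_order_elements H h -> @finite_order_elements G (f h).
Proof. by case=> n n_gt0 hn; exists n; rewrite -?gmulfXn ?hn ?gmulf1. Qed.

Theorem proposition5p5 (R : realType) (G : groupType) (P : pred G)
    (H : subGroupType P) (S : fin_gen_set G) (T : fin_gen_set H) :
  polynomially_full R S -> polynomially_full R T.
Proof.
pose f : UMagmaMorphism.type H G := val.
move=> fullS h /(finite_order_morph f) /fullS.
by apply: poly_growth_class_morph; apply: val_inj.
Qed.
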